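(* Let $Q$ be the fair-coin measure on $\Omega$, let $\mathcal V$ be a free ultrafilter on $\mathbb N$, let $u_{\mathcal V}$ be the two-valued set function defined in the context, and for $\alpha\in(0,1)$ put $P_\alpha=\alpha u_{\mathcal V}+(1-\alpha)Q$. Then $P_\alpha$ satisfies $P_\alpha([\omega\upharpoonright n])>0$ for all $\omega\in\Omega$, $n\in\mathbb N$, and does not have the CHT property, and distinct values of $\alpha$ give distinct probability functions. In particular there are uncountably many such $P_\alpha$.
   Context: $\mathbb N=\{1,2,3,\dots\}$; $\Omega=\{0,1\}^{\mathbb N}$ carries the product topology, and $\mathcal B$ is its Borel $\sigma$-algebra. For $\omega\in\Omega$, $n\in\mathbb N$, $[\omega\upharpoonright n]=\{\omega':\omega'_i=\omega_i,\ 1\le i\le n\}$. The fair-coin measure $Q$ is the countably additive Borel probability with $Q([\omega\upharpoonright n])=2^{-n}$ for all $\omega,n$. For $k\ge1$ let $d_k\in\Omega$ be the path with a $1$ in coordinate $k$ and $0$ in every other coordinate. A free ultrafilter on $\mathbb N$ is an ultrafilter containing no finite set. For $A\in\mathcal B$, $u_{\mathcal V}(A)=1$ if $\{k:d_k\in A\}\in\mathcal V$ and $u_{\mathcal V}(A)=0$ otherwise. A probability function is a finitely additive map $P:\mathcal B\to[0,1]$ with $P(\Omega)=1$. For a probability function $P$ giving every $[\omega\upharpoonright n]$ positive probability, $P_n(A)(\omega)=P(A\cap[\omega\upharpoonright n])/P([\omega\upharpoonright n])$. CHT property of $P$: for $A\in\mathcal B$, $\delta\in(0,1)$, let $C_n(A,\delta)=\{\omega:P_n(A)(\omega)>\delta\}$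 and $D_n(A,\delta)=C_n(A,\delta)\setminus\bigcup_{j<n}C_j(A,\delta)$; the property is that $P\big(\bigcup_{n\ge1}D_n(A,\delta)\big)=\sum_{n\ge1}P(D_n(A,\delta))$ for every $A\in\mathcal B$ and $\delta\in(0,1)$. *)

(* Defs.v *)
From mathcomp Require Import all_boot all_order all_algebra.
From mathcomp Require Import all_classical all_reals all_analysis.
Set Implicit Arguments.
Unset Strict Implicit.
Unset Printing Implicit Defensive.
Import Order.TTheory GRing.Theory Num.Theory.
Import numFieldNormedType.Exports.
Local Open Scope classical_set_scope.
Local Open Scope ring_scope.

(* The positive integers {1, 2, 3, ...} used as coordinate indices are
   relabelled by k |-> k - 1: coordinate i + 1 of a path w is [w i], the path
   d_(k+1) is [d k], and an ultrafilter on {1, 2, 3, ...} is an ultrafilter on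
   [nat].  Lengths n of cylinders are not relabelled; they are natural numbers
   with 0 < n. *)

(* [cantor_space] is [nat -> bool] with the product topology; [Omega] is the
   same type equipped with the Borel sigma-algebra of that topology. *)
Notation Omega := (g_sigma_algebraType (@open cantor_space)).

Definition cylinder (w : Omega) (n : nat) : set Omega :=
  [set w' | forall i, (i < n)%N -> w' i = w i].

Definition fair_coin (R : realType) (Q : probability Omega R) : Prop :=
  forall (w : Omega) (n : nat), (0 < n)%N ->
    Q (cylinder w n) = (2^-1 ^+ n)%:E.

Definition d (k : nat) : Omega := fun i => i == k.

Definition free_ultrafilter (V : set_system nat) : Prop :=
  UltraFilter V /\ (forall K : set nat, finite_set K -> ~ V K).

(* A real-valued set function on the Borel sigma-algebra is represented by a
   total function [set Omega -> R] whose values outside the Borel sets are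
   irrelevant; [on_borel] is the function proper. *)
Definition on_borel (R : realType) (P : set Omega -> R) :
    {A : set Omega | measurable A} -> R :=
  fun A => P (proj1_sig A).

Definition probability_function (R : realType) (P : set Omega -> R) : Prop :=
  [/\ forall A, measurable A -> 0 <= P A <= 1,
      P setT = 1
    & forall A B, measurable A -> measurable B -> A `&` B = set0 ->
        P (A `|` B) = P A + P B].

Definition positive_on_cylinders (R : realType) (P : set Omega -> R) : Prop :=
  forall (w : Omega) (n : nat), (0 < n)%N -> 0 < P (cylinder w n).

Definition cond_prob (R : realType) (P : set Omega -> R) (n : nat)
    (A : set Omega) (w : Omega) : R :=
  P (A `&` cylinder w n) / P (cylinder w n).

Definition C (R : realType) (P : set Omega -> R) (n : nat) (A : set Omega)
    (delta : R) : set Omega :=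
  [set w | delta < cond_prob P n A w].

Definition D (R : realType) (P : set Omega -> R) (n : nat) (A : set Omega)
    (delta : R) : set Omega :=
  C P n A delta `\` \bigcup_(j in [set j | (0 < j < n)%N]) C P j A delta.

(* Meaningful for probability functions positive on cylinders.  The terms of
   the series are then nonnegative, so the sum is taken in [\bar R]. *)
Definition CHT (R : realType) (P : set Omega -> R) : Prop :=
  forall (A : set Omega) (delta : R), measurable A -> 0 < delta < 1 ->
    (P (\bigcup_(n in [set n | (0 < n)%N]) D P n A delta))%:E =
    (\sum_(1 <= n <oo) (P (D P n A delta))%:E)%E.

Definition u (R : realType) (V : set_system nat) (A : set Omega) : R :=
  if `[< V [set k | A (d k)] >] then 1 else 0.

Definition P_alpha (R : realType) (Q : probability Omega R)
    (V : set_system nat) (alpha : R) : set Omega -> R :=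
  fun A => alpha * u R V A + (1 - alpha) * fine (Q A).

(* Main.v *)
(* The paths d_k converge to the zero path, so the purely finitely additive u_V
   gives mass 1 to every cylinder around the zero path and mass 0 to every other
   cylinder.  Let A be the complement of {d_1, d_2, ...}: u_V(A) = 0 and
   Q(A) = 1.  On the cylinders around the zero path the conditional probability
   of A is at most delta = (1 - alpha) / (1 + alpha), on all others it is 1.
   Hence D_n(A, delta) is the cylinder [d_n|n], of P_alpha-measure
   (1 - alpha) 2^-n, and these measures sum to 1 - alpha; but the D_n(A, delta)
   cover everything except the zero path, a set of P_alpha-measure 1.  Since
   P_alpha(A) = 1 - alpha, the measure P_alpha determines alpha. *)
Require Import Defs.
From mathcomp Require Import all_boot all_order all_algebra.
From mathcomp Require Import all_classical all_reals all_analysis.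
From mathcomp Require Import lra.
Import Order.TTheory GRing.Theory Num.Theory.
Import numFieldNormedType.Exports.
Local Open Scope classical_set_scope.
Local Open Scope ring_scope.

(** * Measurability of cylinders, points and [range d] *)

Lemma measurable_coordinate (i : nat) (b : bool) :
  measurable [set w : Omega | w i = b].
Proof.
apply: sub_sigma_algebra.
rewrite (_ : mkset _ = (proj i : cantor_space -> bool) @^-1` [set b]) //.
apply: open_comp; last exact: discrete_open.
by move=> w _; exact: (@proj_continuous nat (fun=> bool) i).
Qed.

Lemma measurable_cylinder (w : Omega) (n : nat) : measurable (cylinder w n).
Proof.
elim: n => [|n IH].
  by rewrite (_ : cylinder w 0 = setT) //; apply/seteqP; split.
rewrite (_ : cylinder w n.+1 = cylinder w n `&` [set w' | w' n = w n]).
  by apply: measurableI => //; exact: measurable_coordinate.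
apply/seteqP; split => w' /=.
  by move=> h; split=> [i lt_in|]; apply: h => //; exact: ltnW.
case=> h hn i; rewrite ltnS leq_eqVlt => /predU1P[->//|]; exact: h.
Qed.

Lemma singleton_bigcap_cylinder (w : Omega) : [set w] = \bigcap_n cylinder w n.
Proof.
apply/seteqP; split => [_ -> n _ //|w' h].
by apply/funext => i; apply: (h i.+1).
Qed.

Lemma measurable_singleton (w : Omega) : measurable [set w].
Proof.
rewrite singleton_bigcap_cylinder.
by apply: bigcapT_measurable => n; exact: measurable_cylinder.
Qed.

Lemma measurable_range_d : measurable (range d).
Proof.
apply: countable_measurable; first exact: measurable_singleton.
exact: card_image_le.
Qed.

(** * Null sets of the fair-coin measure *)

Lemma fair_coin_singleton (R : realType) (Q : probability Omega R) (w : Omega) :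
  fair_coin Q -> Q [set w] = 0%E.
Proof.
move=> hQ; apply/eqP; rewrite eq_le measure_ge0 andbT.
(* The point [w] lies in its own cylinders, whose measures tend to 0. *)
have le_Q n : (0 < n)%N -> fine (Q [set w]) <= 2^-1 ^+ n :> R.
  move=> n_gt0; rewrite -lee_fin fineK ?fin_num_measure//;
    last exact: measurable_singleton.
  rewrite -(hQ w n n_gt0); apply: le_measure; rewrite ?inE.
  - exact: measurable_singleton.
  - exact: measurable_cylinder.
  - by move=> _ ->.
rewrite -(fineK (fin_num_measure Q _ (measurable_singleton w))) lee_fin.
have cvg0 : (GRing.exp (2^-1 : R) : R ^nat) x @[x --> \oo] --> (0 : R).
  by apply: cvg_expr; rewrite ger0_norm; lra.
apply: (cvgr_to_ge cvg0).
by near=> n; apply: le_Q; near: n; exact: nbhs_infty_gt.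
Unshelve. all: by end_near.
Qed.

Lemma fair_coin_range_d (R : realType) (Q : probability Omega R) :
  fair_coin Q -> Q (range d) = 0%E.
Proof.
move=> hQ; apply/negligibleP; first exact: measurable_range_d.
rewrite (_ : range d = \bigcup_k [set d k]).
  apply: negligible_bigcup => k.
  apply/(negligibleP _ (measurable_singleton (d k))).
  exact: fair_coin_singleton.
by apply/seteqP; split => w [k _ wk]; exists k.
Qed.

Lemma probability_setD_null (disp : measure_display) (T : measurableType disp)
    (R : realType) (Q : probability T R) (A N : set T) :
  measurable A -> measurable N -> Q N = 0%E -> Q (A `\` N) = Q A.
Proof.
move=> mA mN QN; apply/eqP; rewrite eq_le; apply/andP; split.
  by apply: le_measure; rewrite ?inE//; exact: measurableD.
rewrite -[leRHS]adde0 -QN -measureU//; last by rewrite setDE -setIA setICl setI0.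
  apply: le_measure; rewrite ?inE//; last by move=> w;
    case: (pselect (N w)); [right|left].
  by apply: measurableU => //; exact: measurableD.
exact: measurableD.
Qed.

(** * The two-valued function [u] *)

Lemma u_ge0 (R : realType) (V : set_system nat) (A : set Omega) : 0 <= u R V A.
Proof. by rewrite /u; case: ifP. Qed.

Lemma u_le1 (R : realType) (V : set_system nat) (A : set Omega) : u R V A <= 1.
Proof. by rewrite /u; case: ifP. Qed.

Lemma u_finite (R : realType) (V : set_system nat) (A : set Omega) :
  free_ultrafilter V -> finite_set [set k | A (d k)] -> u R V A = 0.
Proof. by case=> _ nV finA; rewrite /u asboolF//; exact: nV. Qed.

Lemma u_cofinite (R : realType) (V : set_system nat) (A : set Omega) :
  free_ultrafilter V -> finite_set [set k | ~ A (d k)] -> u R V A = 1.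
Proof.
case=> UV nV finA; rewrite /u asboolT//.
by case: (in_ultra_setVsetC [set k | A (d k)] UV) => // /nV; case.
Qed.

Lemma u_setU (R : realType) (V : set_system nat) (A B : set Omega) :
  UltraFilter V -> A `&` B = set0 -> u R V (A `|` B) = u R V A + u R V B.
Proof.
move=> UV AB0.
have disj k : A (d k) -> B (d k) -> False.
  by move=> Ak Bk; have : (A `&` B) (d k) by []; rewrite AB0.
rewrite /u; case: asboolP => [VAB|nVAB]; case: asboolP => [VA|nVA];
  case: asboolP => [VB|nVB]; rewrite ?addr0 ?add0r//; exfalso.
- by have [k [/disj]] := filter_ex (filterI VA VB).
(* [V] contains the complement of the index set of [A]; intersected with the index set of the union,
   it leaves only indices of [B]. *)
- have [//|VnA] := in_ultra_setVsetC [set k | A (d k)] UV.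
  by apply: nVB; apply: filterS (filterI VAB VnA) => k [[]].
- by apply: nVAB; apply: filterS VA => k; left.
- by apply: nVAB; apply: filterS VA => k; left.
- by apply: nVAB; apply: filterS VB => k; right.
Qed.

(** * Probability axioms and positivity for [P_alpha] *)

Lemma P_alpha_u0 (R : realType) (Q : probability Omega R) (V : set_system nat)
    (alpha : R) (A : set Omega) :
  u R V A = 0 -> P_alpha Q V alpha A = (1 - alpha) * fine (Q A).
Proof. by rewrite /P_alpha => ->; rewrite mulr0 add0r. Qed.

Lemma P_alpha_probability (R : realType) (Q : probability Omega R)
    (V : set_system nat) (alpha : R) :
  free_ultrafilter V -> 0 < alpha < 1 ->
  probability_function (P_alpha Q V alpha).
Proof.
move=> hV alpha01; rewrite /P_alpha; split.
- move=> A mA; have := u_ge0 R V A; have := u_le1 R V A.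
  have : 0 <= fine (Q A) by apply: fine_ge0.
  have : fine (Q A) <= 1.
    by rewrite -lee_fin fineK ?fin_num_measure//; exact: probability_le1.
  by move: alpha01; nra.
- rewrite u_cofinite//.
  by rewrite probability_setT /=; lra.
- move=> A B mA mB AB0; case: hV => UV _; rewrite u_setU//.
  by rewrite measureU// fineD ?fin_num_measure//; lra.
Qed.

(** The fair-coin part alone contributes [(1 - alpha) * 2^-1 ^+ n], and [u] is nonnegative. *)
Lemma P_alpha_positive (R : realType) (Q : probability Omega R)
    (V : set_system nat) (alpha : R) :
  fair_coin Q -> 0 < alpha < 1 -> positive_on_cylinders (P_alpha Q V alpha).
Proof.
move=> hQ alpha01 w n n_gt0; rewrite /P_alpha hQ//=.
have : 0 < 2^-1 ^+ n :> R by apply: exprn_gt0; lra.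
by have := u_ge0 R V (cylinder w n); move: alpha01; nra.
Qed.

(** * The complement of [range d]: its conditional probabilities and its sets [C] and [D] *)

Lemma u_setC_range_d (R : realType) (V : set_system nat) (B : set Omega) :
  free_ultrafilter V -> u R V (~` range d `&` B) = 0.
Proof.
move=> hV; apply: u_finite => //.
by apply: (sub_finite_set _ (finite_set0 _)) => k /= [+ _]; apply; exists k.
Qed.

Lemma fair_coin_setC_range_d (R : realType) (Q : probability Omega R)
    (B : set Omega) :
  fair_coin Q -> measurable B -> Q (~` range d `&` B) = Q B.
Proof.
move=> hQ mB; rewrite setIC -setDE; apply: probability_setD_null => //.
  exact: measurable_range_d.
exact: fair_coin_range_d.
Qed.

Lemma P_alpha_setC_range_d (R : realType) (Q : probability Omega R)
    (V : set_system nat) (alpha : R) (B : set Omega) :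
  fair_coin Q -> free_ultrafilter V -> measurable B ->
  P_alpha Q V alpha (~` range d `&` B) = (1 - alpha) * fine (Q B).
Proof.
move=> hQ hV mB.
by rewrite P_alpha_u0 ?fair_coin_setC_range_d//; exact: u_setC_range_d.
Qed.

(** The 1 at index [i] excludes every [d k] except possibly [d i], so [u] vanishes on the
    cylinder. *)
Lemma P_alpha_cylinder1 (R : realType) (Q : probability Omega R)
    (V : set_system nat) (alpha : R) (w : Omega) (n i : nat) :
  free_ultrafilter V -> (i < n)%N -> w i = true ->
  P_alpha Q V alpha (cylinder w n) = (1 - alpha) * fine (Q (cylinder w n)).
Proof.
move=> hV lt_in wi; apply: P_alpha_u0; apply: u_finite => //.
apply: sub_finite_set (finite_set1 i) => k /= /(_ i lt_in).
by rewrite wi => /eqP.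
Qed.

(** Every [d k] with [n <= k] begins with [n] zeros, so [u] is 1 on the cylinder. *)
Lemma P_alpha_cylinder0 (R : realType) (Q : probability Omega R)
    (V : set_system nat) (alpha : R) (w : Omega) (n : nat) :
  free_ultrafilter V -> (forall i, (i < n)%N -> w i = false) ->
  P_alpha Q V alpha (cylinder w n)
    = alpha + (1 - alpha) * fine (Q (cylinder w n)).
Proof.
move=> hV w0; rewrite /P_alpha u_cofinite ?mulr1//.
apply: sub_finite_set (finite_II n) => k /= ncyl.
rewrite ltnNge; apply/negP => le_nk; apply: ncyl => i lt_in.
by rewrite w0//; apply/eqP => ik; move: le_nk; rewrite -ik leqNgt lt_in.
Qed.

(* [(1 - alpha) / (1 + alpha)] is the conditional probability of [~` range d]
   on the zero cylinder of length 1, the largest among all zero cylinders. *)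
Lemma C_setC_range_d (R : realType) (Q : probability Omega R)
    (V : set_system nat) (alpha : R) (n : nat) :
  fair_coin Q -> free_ultrafilter V -> 0 < alpha < 1 -> (0 < n)%N ->
  C (P_alpha Q V alpha) n (~` range d) ((1 - alpha) / (1 + alpha))
    = [set w | exists2 i, (i < n)%N & w i = true].
Proof.
move=> hQ hV alpha01 n_gt0; apply/seteqP; split=> w /=; rewrite /C /cond_prob /=.
  apply: contraPP => no1; have w0 i : (i < n)%N -> w i = false.
    by move=> lt_in; apply/negP => wi; apply: no1; exists i.
  rewrite P_alpha_setC_range_d//; last exact: measurable_cylinder.
  rewrite P_alpha_cylinder0// hQ//=; apply/negP; rewrite -leNgt.
  have x_gt0 : 0 < 2^-1 ^+ n :> R by apply: exprn_gt0; lra.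
  have x_le : 2^-1 ^+ n <= 2^-1 :> R.
    by rewrite -[leRHS]expr1; apply: ler_wiXn2l => //; lra.
  (* With x = [2^-1 ^+ n], clearing denominators and cancelling [1 - alpha] leaves x (1 + alpha) <=
     alpha + (1 - alpha) x, that is, x <= 1/2. *)
  rewrite ler_pdivrMr; last by move: alpha01; nra.
  rewrite mulrAC ler_pdivlMr; last by move: alpha01; lra.
  rewrite -mulrA ler_pM2l; last by move: alpha01; lra.
  by move: alpha01 x_gt0 x_le; set x := _ ^+ n; nra.
case=> i lt_in wi; rewrite P_alpha_setC_range_d//;
  last exact: measurable_cylinder.
(* Numerator and denominator agree, so the conditional probability is 1. *)
rewrite (P_alpha_cylinder1 _ _ _ _ _ _ i)// divff.
  by rewrite ltr_pdivrMr; move: alpha01; lra.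
rewrite hQ//= mulf_neq0//; apply/eqP; move: alpha01; lra.
Qed.

(** Both sides consist of the paths whose first 1 is at index [n]: a 1 among the first [n.+1]
    coordinates, none among the first [n]. *)
Lemma D_setC_range_d (R : realType) (Q : probability Omega R)
    (V : set_system nat) (alpha : R) (n : nat) :
  fair_coin Q -> free_ultrafilter V -> 0 < alpha < 1 ->
  D (P_alpha Q V alpha) n.+1 (~` range d) ((1 - alpha) / (1 + alpha))
    = cylinder (d n) n.+1.
Proof.
move=> hQ hV alpha01; rewrite /D C_setC_range_d//; apply/seteqP; split => w /=.
  case=> -[i lt_in wi] no1 j.
  have w0 k : (k < n)%N -> w k = false.
    (* A 1 at index [k < n] would already put [w] into the set [C] of length [k.+1 < n.+1]. *)
    move=> lt_kn; apply/negP => wk; apply: no1; exists k.+1 => //=.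
    by rewrite C_setC_range_d//; exists k.
  rewrite ltnS leq_eqVlt => /predU1P[->|lt_jn]; last first.
    by rewrite w0// /d ltn_eqF.
  rewrite /d eqxx; move: lt_in; rewrite ltnS leq_eqVlt => /predU1P[<-//|/w0].
  by rewrite wi.
move=> cyl; split.
  by exists n => //; rewrite cyl// /d eqxx.
case=> j /= /andP[j_gt0 lt_jn]; rewrite C_setC_range_d// => -[i lt_ij].
have lt_in : (i < n)%N by exact: leq_trans lt_ij _.
by rewrite (cyl i (ltnW lt_in)) /d ltn_eqF.
Qed.

Lemma sum_half_pow (R : realType) (n : nat) :
  \sum_(0 <= i < n) 2^-1 ^+ i.+1 = 1 - 2^-1 ^+ n :> R.
Proof.
elim: n => [|n IH]; first by rewrite big_geq// expr0 subrr.
by rewrite big_nat_recr//= IH exprS; lra.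
Qed.

(** * Failure of the CHT property *)

Lemma P_alpha_not_CHT (R : realType) (Q : probability Omega R)
    (V : set_system nat) (alpha : R) :
  fair_coin Q -> free_ultrafilter V -> 0 < alpha < 1 ->
  ~ CHT (P_alpha Q V alpha).
Proof.
move=> hQ hV alpha01 /(_ (~` range d) ((1 - alpha) / (1 + alpha))).
set delta := _ / _; set P := P_alpha Q V alpha.
have delta01 : 0 < delta < 1.
  apply/andP; split; first by apply: divr_gt0; move: alpha01; lra.
  by rewrite ltr_pdivrMr; move: alpha01; lra.
move=> /(_ (measurableC measurable_range_d) delta01).
have -> : \bigcup_(n in [set n | (0 < n)%N]) D P n (~` range d) delta
    = ~` [set (fun=> false) : Omega].
  apply/seteqP; split => w /=.
    case=> -[//|n] _; rewrite D_setC_range_d// => /(_ n (ltnSn n)) wn w0.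
    by move: wn; rewrite w0 /d eqxx.
  move=> w_neq0; have ex1 : exists i, w i.
    apply: contrapT => no1; apply: w_neq0; apply/funext => i.
    by apply/negP => wi; apply: no1; exists i.
  (* The position [n] of the first 1 determines which [D] contains [w]. *)
  case: (ex_minnP ex1) => n wn n_min; exists n.+1 => //.
  rewrite D_setC_range_d// => i; rewrite ltnS leq_eqVlt => /predU1P[->|lt_in].
    by rewrite wn /d eqxx.
  rewrite /d ltn_eqF//; apply/negP => /n_min.
  by rewrite leqNgt lt_in.
have -> : P (~` [set (fun=> false) : Omega]) = 1.
  (* The zero path is none of the [d k] and is null for [Q], so both parts of [P] give its
     complement full mass. *)
  rewrite /P /P_alpha u_cofinite//; last first.
    apply: (sub_finite_set _ (finite_set0 _)) => k /=; apply.
    by move=> /(congr1 (fun w => w k)); rewrite /d eqxx.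
  rewrite probability_setC; last exact: measurable_singleton.
  by rewrite fair_coin_singleton// sube0 /=; lra.
have PD n : P (D P n.+1 (~` range d) delta) = (1 - alpha) * 2^-1 ^+ n.+1.
  by rewrite /P D_setC_range_d// (P_alpha_cylinder1 _ _ _ _ _ _ n)// ?hQ// /d eqxx.
(* An upper bound on the sum suffices: equality would give 1 <= 1 - alpha. *)
suff le_sum : (\sum_(1 <= n <oo) (P (D P n (~` range d) delta))%:E
    <= (1 - alpha)%:E)%E.
  by move=> eq1; move: le_sum; rewrite -eq1 lee_fin; move: alpha01; lra.
apply: lime_le.
  apply: is_cvg_nneseries => -[//|n] _ _; rewrite PD lee_fin mulr_ge0//.
  by move: alpha01; lra.
apply: nearW => -[|n]; first by rewrite big_geq// lee_fin; move: alpha01; lra.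
(* The partial sum below [n.+1] has [n] terms and equals [(1 - alpha) * (1 - 2^-1 ^+ n)]. *)
rewrite sumEFin lee_fin big_add1 /=.
under eq_bigr do rewrite PD.
rewrite -mulr_sumr sum_half_pow.
have : 0 <= 2^-1 ^+ n :> R by rewrite exprn_ge0//; lra.
by move: alpha01; nra.
Qed.

(** * Distinctness and uncountability of the family *)

Lemma on_borel_P_alpha_inj (R : realType) (Q : probability Omega R)
    (V : set_system nat) :
  fair_coin Q -> free_ultrafilter V ->
  injective (fun alpha : R => on_borel (P_alpha Q V alpha)).
Proof.
move=> hQ hV alpha beta.
move=> /(congr1 (fun f => f (exist _ _ (measurableC measurable_range_d)))).
rewrite /on_borel /= -[~` range d]setIT !P_alpha_setC_range_d//.
by rewrite probability_setT /=; lra.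
Qed.

(** A countable set has Lebesgue measure 0, whereas this interval has measure 1. *)
Lemma uncountable_open_unit_interval (R : realType) :
  ~ countable [set x : R | 0 < x < 1].
Proof.
rewrite (_ : mkset _ = `]0, 1[%classic); last first.
  by apply/seteqP; split => x /=; rewrite in_itv.
move=> /countable_lebesgue_measure0 /eqP.
by rewrite lebesgue_measure_itv /= lte_fin ltr01 sube0 eqe oner_eq0.
Qed.

Theorem corollary6p4 (R : realType) (Q : probability Omega R)
    (hQ : fair_coin Q) (V : set_system nat) (hV : free_ultrafilter V) :
  [/\ forall alpha : R, 0 < alpha < 1 ->
        [/\ probability_function (P_alpha Q V alpha),
            positive_on_cylinders (P_alpha Q V alpha)
          & ~ CHT (P_alpha Q V alpha)],
      forall alpha beta : R, 0 < alpha < 1 -> 0 < beta < 1 -> alpha <> beta ->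
        on_borel (P_alpha Q V alpha) <> on_borel (P_alpha Q V beta)
    & ~ countable [set on_borel (P_alpha Q V alpha) |
                    alpha in [set alpha : R | 0 < alpha < 1]]].
Proof.
have inj := on_borel_P_alpha_inj R Q V hQ hV.
split.
- move=> alpha alpha01; split.
  + exact: P_alpha_probability.
  + exact: P_alpha_positive.
  + exact: P_alpha_not_CHT.
- by move=> alpha beta _ _ neq /inj.
(* By injectivity the family is equinumerous with the open unit interval. *)
- rewrite (eq_countable (inj_card_eq _)).
    exact: uncountable_open_unit_interval.
  by move=> x y _ _ /inj.
Qed.
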